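(* Let $k\ge 1$ be an integer and let $\alpha<H(n_{k-1})$. Then there exist a positive integer $\beta$ and a uniform metric space (one with $n_{k-1}+1$ points suffices) such that no randomized online algorithm for the weighted $k$-server problem on this space with server weights $1,\beta,\beta^2,\ldots,\beta^{k-1}$ is $\alpha$-competitive against an oblivious adversary. In particular, the randomized competitive ratio of weighted $k$-server on uniform metric spaces is at least $H(n_{k-1})$.
   Context: The sequence $n_0,n_1,\ldots$ is defined by $n_0=1$ and, for $i>0$, $n_i=\left(\lceil n_{i-1}/2\rceil+1\right)\cdot\left(\lfloor n_{i-1}/2\rfloor+1\right)$. $H(n)=\sum_{i=1}^n 1/i$ denotes the $n$-th harmonic number. Weighted $k$-server problem on a uniform metric space (all distinct points at distance $1$): there are $k$ servers with weights $w_1\le\cdots\le w_k$, each located at a point of the space, starting from a given initial configuration. Requests (points of the space) arrive one at a time; when a point is requested, a server must be at that point after serving it (servers may be moved at any time), and moving server $i$ to a different point costs $w_i$. An online algorithm decides its movements knowing only the requests so far. A randomized online algorithm is $c$-competitive against an oblivious adversary if on every request sequence (fixed in advance, independent of the algorithm's random choices) and every initial configuration, its expected cost is at most $c$ times the optimal (offline) cost of serving that sequence from the same initial configuration. *)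

(* Defs.v *)
From HB Require Import structures.
From mathcomp Require Import all_boot all_order all_algebra.
From mathcomp Require Import all_classical all_reals all_analysis.
Set Implicit Arguments. Unset Strict Implicit. Unset Printing Implicit Defensive.
Import Order.TTheory GRing.Theory Num.Theory.
Local Open Scope classical_set_scope.
Local Open Scope ring_scope.

Fixpoint nseqk (i : nat) : nat :=
  match i with
  | 0 => 1
  | i'.+1 => let m := nseqk i' in ((uphalf m).+1 * (m./2).+1)%N
  end.

Definition harmonic_number (R : realType) (n : nat) : R :=
  \sum_(1 <= i < n.+1) (i%:R)^-1.

(* Uniform metric space on the points 'I_m (all distinct points at distance 1).
   A configuration of k servers: server i sits at point c i. *)
Definition config (m k : nat) := {ffun 'I_k -> 'I_m}.

(* Cost of moving from configuration c to c' on the uniform metric: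
   each server i that changes point pays its weight w i (distance 1).
   (Moving a server several times between requests only costs more, so
   recording the configuration after each request is w.l.o.g.) *)
Definition move_cost (R : realType) (m k : nat) (w : 'I_k -> R)
  (c c' : config m k) : R := \sum_(i < k | c i != c' i) w i.

Fixpoint sched_cost (R : realType) (m k : nat) (w : 'I_k -> R)
  (c : config m k) (cs : seq (config m k)) : R :=
  match cs with
  | [::] => 0
  | c' :: cs' => move_cost w c c' + sched_cost w c' cs'
  end.

Definition serves (m k : nat) (sigma : seq 'I_m) (cs : seq (config m k)) : bool :=
  all2 (fun (c : config m k) (r : 'I_m) => [exists i, c i == r]) cs sigma.

Definition opt_cost (R : realType) (m k : nat) (w : 'I_k -> R)
  (init : config m k) (sigma : seq 'I_m) : \bar R :=
  \big[Order.min/+oo%E]_(cs : (size sigma).-tuple (config m k) | serves sigma cs)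
     (sched_cost w init cs)%:E.

(* A randomized online algorithm, with random seed omega drawn from a
   probability space: A omega init s is the configuration right after serving
   the last request of the prefix s (it only sees the initial configuration
   and the requests so far). *)
Definition alg_sched (m k : nat) (Omega : Type)
  (A : Omega -> config m k -> seq 'I_m -> config m k)
  (omega : Omega) (init : config m k) (sigma : seq 'I_m) : seq (config m k) :=
  [seq A omega init (take t.+1 sigma) | t <- iota 0 (size sigma)].

Definition randomized_online_alg (m k : nat) (d : measure_display)
  (Omega : measurableType d)
  (A : Omega -> config m k -> seq 'I_m -> config m k) : Prop :=
  (forall omega init s r, [exists i, A omega init (rcons s r) i == r]) /\
  (forall init s c, measurable [set omega | A omega init s = c]).

Definition competitive (R : realType) (m k : nat) (d : measure_display)
  (Omega : measurableType d) (P : probability Omega R) (w : 'I_k -> R)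
  (A : Omega -> config m k -> seq 'I_m -> config m k) (c : R) : Prop :=
  forall (init : config m k) (sigma : seq 'I_m),
    (\int[P]_omega (sched_cost w init (alg_sched A omega init sigma))%:E
      <= c%:E * opt_cost w init sigma)%E.

(* Main.v *)
(* By induction on l, every set S of [nseqk l] points carries a fixed request
   sequence whose cost is at least beta^l for any schedule that starts with no
   server of index >= l in S, while it can be served at cost O(beta^(l-1)) by
   the servers below l as soon as some server of index >= l sits in S.  For
   l+1, choose Q_0, ..., Q_r in S of size [nseqk l] and run beta rounds
   of the sequences of Q_0, ..., Q_r: server l always misses some Q_i, so each
   round costs beta^l; but if a heavier server sits at p in S, then server l
   can be moved once to a point q such that every Q_i contains p or q.

   Let l = k-1 be the heaviest server.  On n+1 points, n = [nseqk (k-1)],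
   "hitting" p means requesting the sequence of the complement of p: this costs
   beta^l if the heaviest server is at p and almost nothing otherwise.  Knowing
   the distribution of the algorithm's heaviest server, the adversary first hits
   its initial position, then keeps a set U of points never hit: it hits a point
   outside U that still carries probability delta, or else the most likely point
   of U.  The expected costs add up to nearly beta^l (1 + 1/n + ... + 1/2),
   whereas moving the heaviest server to the surviving point of U costs
   beta^l offline. *)
Require Import Defs.
From HB Require Import structures.
From mathcomp Require Import all_boot all_order all_algebra.
From mathcomp Require Import all_classical all_reals all_analysis.
From mathcomp Require Import measurable_realfun ring lra.
Import Order.TTheory GRing.Theory Num.Theory.
Local Open Scope ring_scope.

Set Implicit Arguments.
Unset Strict Implicit.

(** * Covering sets on a grid *)

(** Lay [S] out as a grid with [(uphalf n).+1] rows and [(n./2).+1] columns; Q_i is column 0 without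
    its i-th entry, plus the rest of row i, hence [uphalf n + n./2 = n] points. A point (i, 0) is
    missed by Q_i only, so any other point of column 0 completes it; a point (i, j) with j > 0 lies
    in Q_i only, and (i, 0) completes it. *)
Lemma grid_sets (T : finType) (n : nat) (S : {set T}) :
  (0 < n)%N -> #|S| = ((uphalf n).+1 * (n./2).+1)%N ->
  exists Q : 'I_(uphalf n).+1 -> {set T},
    [/\ forall i, #|Q i| = n,
        forall i, Q i \subset S,
        forall p, exists i, p \notin Q i &
        forall p, p \in S ->
          exists q, forall i, (p \in Q i) || (q \in Q i)].
Proof.
set a := uphalf n; set b := n./2 => n_gt0 cS.
have abn : (a + b)%N = n.
  by rewrite /a /b uphalf_half -addnA addnn odd_double_half.
have a_gt0 : (0 < a)%N by rewrite uphalf_gt0.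
have other (i : 'I_a.+1) : exists i', i' != i.
  exists (if i == ord0 then ord_max else ord0).
  have [->|] := eqVneq i ord0; last by rewrite eq_sym.
  by rewrite -val_eqE /= -lt0n.
have cG : #|{: 'I_a.+1 * 'I_b.+1}| = #|S| by rewrite card_prod !card_ord cS.
pose f x := enum_val (cast_ord cG (enum_rank x)).
have f_inj : injective f.
  by move=> x y /enum_val_inj /cast_ord_inj /enum_rank_inj.
(* On the grid, (i, 0) lies in every set but the i-th one, and (i, j) with
   j > 0 lies in the i-th one only. *)
pose g i := [set x : 'I_a.+1 * 'I_b.+1 |
             if x.2 == ord0 then x.1 != i else x.1 == i].
exists (fun i => f @: g i); split.
- move=> i; rewrite card_imset //.
  have -> : g i = (finset.setX [set~ i] [set ord0] :|:
                   finset.setX [set i] [set~ ord0])%SET.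
    apply/finset.setP => -[x y]; rewrite !inE /=.
    by case: eqP => /= _; rewrite ?andbT ?andbF ?orbF.
  rewrite cardsU [in X in (_ - X)%N](_ : (_ :&: _)%SET = finset.set0) ?cards0.
    by rewrite !cardsX !cardsC1 !cards1 !card_ord /= muln1 mul1n subn0.
  by apply/finset.setP => -[x y]; rewrite !inE /=; case: eqP; rewrite ?andbF.
- move=> i; apply/fintype.subsetP => _ /imsetP[x _ ->].
  by have := enum_valP (cast_ord cG (enum_rank x)).
- move=> p; case: (boolP [exists x, f x == p]) => [/existsP[x /eqP <-]|].
    have [x2|x2] := eqVneq x.2 ord0.
      by exists x.1; rewrite mem_imset // inE x2 eqxx /= eqxx.
    have [i' ne] := other x.1.
    by exists i'; rewrite mem_imset // inE (negPf x2) eq_sym.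
  move=> /existsPn np; exists ord0; apply/imsetP => -[x _ px].
  by have := np x; rewrite px eqxx.
- move=> p pS.
  have [x ->] : exists x, p = f x.
    exists (enum_val (cast_ord (esym cG) (enum_rank_in pS p))).
    by rewrite /f enum_valK cast_ordKV enum_rankK_in.
  have [x2|x2] := eqVneq x.2 ord0; last first.
    exists (f (x.1, ord0)) => i; rewrite !mem_imset // !inE /= (negPf x2).
    by case: eqP.
  have [i' ne] := other x.1.
  exists (f (i', ord0)) => i; rewrite !mem_imset // !inE /= x2 /=.
  by have [<-|] := eqVneq x.1 i.
Qed.

Lemma nseqk_gt0 (i : nat) : (0 < nseqk i)%N.
Proof. by case: i => //= i; rewrite muln_gt0. Qed.

(** * Costs of schedules *)

Section Schedules.
Variables (R : realType) (m k : nat) (w : 'I_k -> R).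
Hypothesis w_ge0 : forall i, 0 <= w i.
Implicit Types (c : config m k) (cs : seq (config m k)).

Lemma move_cost_ge0 c c' : 0 <= move_cost w c c'.
Proof. exact: sumr_ge0. Qed.

Lemma sched_cost_ge0 c cs : 0 <= sched_cost w c cs.
Proof. by elim: cs c => //= c' cs IH c; rewrite addr_ge0 ?move_cost_ge0. Qed.

Lemma move_cost_triangle c c' c'' :
  move_cost w c c'' <= move_cost w c c' + move_cost w c' c''.
Proof.
rewrite /move_cost !(big_mkcond (fun i => _ i != _ i)) -big_split /=.
apply: ler_sum => i _; have wi := w_ge0 i.
have [->|ne] := eqVneq (c i) (c' i); first by rewrite add0r.
by rewrite /=; case: ifP => _; case: ifP => _; lra.
Qed.

(** Lets an offline schedule relocate servers first without spending a request on it. *)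
Lemma sched_cost_start c c' cs :
  sched_cost w c cs <= move_cost w c c' + sched_cost w c' cs.
Proof.
case: cs => [|c'' cs] /=; first by rewrite addr0 move_cost_ge0.
by rewrite addrA lerD2r move_cost_triangle.
Qed.

Lemma sched_cost_cat c cs1 cs2 :
  sched_cost w c (cs1 ++ cs2) =
  sched_cost w c cs1 + sched_cost w (last c cs1) cs2.
Proof. by elim: cs1 c => [|c1 cs1 IH] c /=; rewrite ?add0r // IH addrA. Qed.

Lemma move_cost_ge c c' i : c i != c' i -> w i <= move_cost w c c'.
Proof. by move=> h; rewrite /move_cost (bigD1 i) //= lerDl sumr_ge0. Qed.

Lemma sched_cost_ge c cs i : last c cs i != c i -> w i <= sched_cost w c cs.
Proof.
elim: cs c => [|c' cs IH] c /=; first by rewrite eqxx.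
have [-> ne|ne _] := eqVneq (c i) (c' i).
  by rewrite ler_wpDl ?move_cost_ge0 ?IH.
by rewrite ler_wpDr ?sched_cost_ge0 ?move_cost_ge.
Qed.

Lemma serves_size (s : seq 'I_m) cs : serves s cs -> size cs = size s.
Proof. by rewrite /serves all2E => /andP[/eqP]. Qed.

Lemma serves_cat (s1 s2 : seq 'I_m) cs1 cs2 :
  serves s1 cs1 -> serves s2 cs2 -> serves (s1 ++ s2) (cs1 ++ cs2).
Proof.
move=> h1 h2; have e1 := serves_size h1.
rewrite /serves in h1 h2 *.
by elim: cs1 s1 e1 h1 => [|c cs1 IH] [|r s1] //= [e] /andP[-> /(IH _ e)].
Qed.

Lemma serves_split (s1 s2 : seq 'I_m) cs :
  serves (s1 ++ s2) cs ->
  exists cs1 cs2, [/\ cs = cs1 ++ cs2, serves s1 cs1 & serves s2 cs2].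
Proof.
rewrite /serves; elim: s1 cs => [|r s1 IH] cs /=; first by exists [::], cs.
case: cs => //= c cs /andP[cr /IH[cs1 [cs2 [-> h1 h2]]]].
by exists (c :: cs1), cs2; rewrite /= cr.
Qed.

End Schedules.

(** * Blocks of requests, hard or easy according to where the heavy servers are *)

Section Blocks.
Variables (R : realType) (m k beta : nat).
Hypothesis beta_gt0 : (0 < beta)%N.
Let wt (i : 'I_k) : R := (beta ^ i)%:R.
Implicit Types (c : config m k) (cs : seq (config m k)) (l : nat).
Implicit Types (S : {set 'I_m}) (s : seq 'I_m).

Definition hard l S s :=
  forall c cs, (forall i : 'I_k, (l <= i)%N -> c i \notin S) ->
  serves s cs -> (beta ^ l)%:R <= sched_cost wt c cs.

(** The clause on [last] restores the premise, so that blocks can be chained. *)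
Definition easy l S s (B : R) :=
  forall c, (exists2 i : 'I_k, (l <= i)%N & c i \in S) ->
  exists cs, [/\ serves s cs, sched_cost wt c cs <= B &
                 forall i : 'I_k, (l <= i)%N -> last c cs i = c i].

Lemma wt_ge0 i : 0 <= wt i. Proof. by rewrite ler0n. Qed.

Lemma wt_ge l (i : 'I_k) : (l <= i)%N -> (beta ^ l)%:R <= wt i.
Proof. by move=> li; rewrite ler_nat leq_pexp2l. Qed.

(** Only end positions are compared: a heavy server may leave and come back in the second case,
    which is harmless since the hardness of a block depends only on where it starts. *)
Lemma heavy_moves l c cs :
  (beta ^ l)%:R <= sched_cost wt c cs \/
  forall i : 'I_k, (l <= i)%N -> last c cs i = c i.
Proof.
have [/existsP[i /andP[li ne]]|/existsPn h] :=
    boolP [exists i : 'I_k, (l <= i)%N && (last c cs i != c i)].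
  by left; apply: le_trans (wt_ge li) _; exact: (sched_cost_ge wt_ge0).
by right => i li; have := h i; rewrite li negbK => /eqP.
Qed.

Section Flatten.
Variables (J : eqType) (S : J -> {set 'I_m}) (rho : J -> seq 'I_m).
Variables (l : nat) (B : R).
Hypothesis rho_hard : forall j, hard l (S j) (rho j).
Hypothesis rho_easy : forall j, easy l (S j) (rho j) B.

Lemma easy_flatten (js : seq J) c :
  (forall j, j \in js -> exists2 i : 'I_k, (l <= i)%N & c i \in S j) ->
  exists cs, [/\ serves (flatten (map rho js)) cs,
    sched_cost wt c cs <= (size js)%:R * B &
    forall i : 'I_k, (l <= i)%N -> last c cs i = c i].
Proof.
elim: js c => [|j js IH] c cS.
  by exists [::]; split => //=; rewrite mul0r.
have [cs1 [h1 le1 l1]] := rho_easy (cS j (mem_head _ _)).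
have [|cs2 [h2 le2 l2]] := IH (last c cs1).
  move=> j' j'js; have [|i li iS] := cS j'; first by rewrite inE j'js orbT.
  by exists i; rewrite ?l1.
exists (cs1 ++ cs2); split => /=; first exact: serves_cat.
  by rewrite sched_cost_cat -natr1 mulrDl mul1r addrC lerD.
by move=> i li; rewrite last_cat l2 ?l1.
Qed.

Lemma hard_flatten (js : seq J) j c cs :
  j \in js -> (forall i : 'I_k, (l <= i)%N -> c i \notin S j) ->
  serves (flatten (map rho js)) cs -> (beta ^ l)%:R <= sched_cost wt c cs.
Proof.
case/splitPr => js1 js2 cS; rewrite map_cat flatten_cat /=.
move=> /serves_split[cs1 [_ [-> _ /serves_split[cs2 [cs3 [-> h2 _]]]]]].
rewrite !sched_cost_cat.
have g1 := sched_cost_ge0 wt_ge0 c cs1.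
have g3 := sched_cost_ge0 wt_ge0 (last (last c cs1) cs2) cs3.
have [le1|l1] := heavy_moves l c cs1.
  have g2 := sched_cost_ge0 wt_ge0 (last c cs1) cs2; lra.
suff: (beta ^ l)%:R <= sched_cost wt (last c cs1) cs2 by lra.
by apply: rho_hard h2 => i li; rewrite l1 ?cS.
Qed.

(** At the start of a round, server l misses some [S j] and the servers above it are outside [S'],
    so block j forces a cost [beta ^ l]. This can fail in a later round only if a server above l has
    changed place, which alone pays [beta ^ l.+1]. *)
Lemma hard_rounds (S' : {set 'I_m}) (js : seq J) (t : nat) c cs :
  (l < k)%N -> (forall j, S j \subset S') ->
  (forall p, exists2 j, j \in js & p \notin S j) ->
  (forall i : 'I_k, (l < i)%N -> c i \notin S') ->
  serves (flatten (map rho (flatten (nseq t js)))) cs ->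
  (t * beta ^ l)%:R <= sched_cost wt c cs \/
  (beta ^ l.+1)%:R <= sched_cost wt c cs.
Proof.
move=> lk SS' avoid; elim: t c cs => [|t IH] c cs cS /=.
  by rewrite mul0n (sched_cost_ge0 wt_ge0); left.
rewrite map_cat flatten_cat => /serves_split[cs1 [cs2 [-> h1 h2]]].
rewrite sched_cost_cat.
have g2 := sched_cost_ge0 wt_ge0 (last c cs1) cs2.
have [le1|l1] := heavy_moves l.+1 c cs1; first by right; lra.
have [j jjs jp] := avoid (c (Ordinal lk)).
have le1 : (beta ^ l)%:R <= sched_cost wt c cs1.
  apply: (hard_flatten jjs) h1 => i; rewrite leq_eqVlt => /predU1P[li|li].
    by rewrite (_ : i = Ordinal lk) //; exact: val_inj.
  by apply: contra (cS i li); exact: (fintype.subsetP (SS' j)).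
have [|le2|le2] := IH (last c cs1) cs2 _ h2.
- by move=> i li; rewrite l1 ?cS.
- by left; rewrite mulSn natrD lerD.
- by right; apply: le_trans le2 _; rewrite lerDr (sched_cost_ge0 wt_ge0).
Qed.

End Flatten.
End Blocks.

(** [K] is fixed before [beta], so the ratio K / beta of the two bounds vanishes as [beta] grows.
    The quotient by [beta] avoids an exponent l - 1 at l = 0. *)
Lemma hard_easy_sequence (R : realType) (l : nat) :
  exists K : nat, forall m k beta (S : {set 'I_m}),
    (0 < beta)%N -> (l <= k)%N -> #|S| = nseqk l ->
    exists s, hard R k beta l S s /\
              easy k beta l S s ((K * beta ^ l)%:R / beta%:R : R).
Proof.
elim: l => [|l [K IH]].
  exists 0%N => m k beta S b0 _ /eqP/cards1P[q ->]; exists [:: q]; split.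
  - move=> c [|c' []] //= cS; rewrite ?andbT ?andbF // => /existsP[i /eqP iq].
    rewrite addr0; apply: le_trans (wt_ge R b0 (leq0n i)) _.
    apply: move_cost_ge; first exact: wt_ge0.
    by have := cS i isT; rewrite inE iq.
  - move=> c [i _ /set1P iq]; exists [:: c]; split => //=.
      by rewrite andbT; apply/existsP; exists i; apply/eqP.
    by rewrite addr0 mul0n mul0r /move_cost big1 // => j; rewrite eqxx.
(* One move of server l, at cost [beta ^ l], plus [beta] rounds of [(uphalf (nseqk l)).+1] blocks at
   cost [K * beta ^ l / beta] each. *)
exists (1 + (uphalf (nseqk l)).+1 * K)%N => m k beta S b0 lk cS.
have [Q [cQ QS avoid cover]] := grid_sets (nseqk_gt0 l) cS.
have /choice[rho rhoP] : forall i, exists s, hard R k beta l (Q i) s /\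
    easy k beta l (Q i) s ((K * beta ^ l)%:R / beta%:R : R).
  by move=> i; apply: IH => //; exact: ltnW.
have rho_hard i : hard R k beta l (Q i) (rho i) by have [] := rhoP i.
have rho_easy i : easy k beta l (Q i) (rho i) ((K * beta ^ l)%:R / beta%:R : R).
  by have [] := rhoP i.
set js := enum 'I_(uphalf (nseqk l)).+1.
exists (flatten (map rho (flatten (nseq beta js)))); split.
  have avoid' p : exists2 i, i \in js & p \notin Q i.
    by have [i pi] := avoid p; exists i; rewrite ?mem_enum.
  move=> c cs cout h.
  (* With [beta] rounds both alternatives give [beta ^ l.+1]. *)
  by have [] := hard_rounds b0 rho_hard lk QS avoid' cout h; rewrite -?expnS.
move=> c [i li /cover[q qP]].
pose o := Ordinal lk.
pose c' : config m k := [ffun j => if j == o then q else c j].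
have [|cs [h le1 l1]] :=
    easy_flatten rho_easy (js := flatten (nseq beta js)) (c := c').
  move=> j _; have /orP[jc|jq] := qP j.
    exists i; first exact: ltnW.
    by rewrite ffunE; case: eqP => // io; move: li; rewrite io /= ltnn.
  by exists o; rewrite // ffunE eqxx.
exists cs; split => //.
  apply: le_trans (sched_cost_start (wt_ge0 R _) c c' cs) _.
  have le2 : move_cost (fun i : 'I_k => (beta ^ i)%:R : R) c c' <=
      (beta ^ l)%:R.
    rewrite /move_cost big_mkcond (bigD1 o) //= big1 ?addr0 => [|j /negPf jo].
      by case: ifP.
    by rewrite ffunE jo eqxx.
  have sz : size (flatten (nseq beta js)) = (beta * (uphalf (nseqk l)).+1)%N.
    by rewrite size_flatten /shape map_nseq sumn_nseq size_enum_ord mulnC.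
  apply: le_trans (lerD le2 le1) _.
  have b0' : beta%:R != 0 :> R by rewrite pnatr_eq0 -lt0n.
  rewrite sz le_eqVlt; apply/orP; left; apply/eqP.
  by rewrite expnS !natrM natrD natrM; field.
move=> j lj.
have cj : c' j = c j.
  by rewrite ffunE; case: eqP => // jo; move: lj; rewrite jo /= ltnn.
by case: cs l1 {h le1} => //= c1 cs l1; rewrite l1 // ltnW.
Qed.

(** * Harmonic numbers and the hitting game *)

Lemma harmonic_numberS (R : realType) n :
  harmonic_number R n.+1 = harmonic_number R n + n.+1%:R^-1.
Proof. by rewrite /harmonic_number big_nat_recr. Qed.

Lemma harmonic_number1 (R : realType) : harmonic_number R 1 = 1.
Proof. by rewrite harmonic_numberS /harmonic_number big_geq // add0r invr1. Qed.

Lemma harmonic_number_ge1 (R : realType) n :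
  (0 < n)%N -> 1 <= harmonic_number R n.
Proof.
case: n => // n _; elim: n => [|n IH]; first by rewrite harmonic_number1.
by rewrite harmonic_numberS ler_wpDr ?invr_ge0.
Qed.

Section Gain.
Variable R : realType.

(** With masses for [mu] this is an expected number of successful hits; with the 0/1 indicators of
    one run it is the actual number. *)
Fixpoint gain (T : Type) (mu : seq T -> T -> R) (h ps : seq T) : R :=
  if ps is p :: ps' then mu h p + gain mu (rcons h p) ps' else 0.

Lemma gain_ge0 (T : Type) (mu : seq T -> T -> R) h ps :
  (forall h p, 0 <= mu h p) -> 0 <= gain mu h ps.
Proof. by move=> mu0; elim: ps h => //= p ps IH h; rewrite addr_ge0. Qed.

(* [mu h p] is the probability mass found at p after hitting the points of h;
   t is the budget of hits outside U. *)
Lemma exists_gain (T : finType) (mu : seq T -> T -> R) (delta : R) :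
  (forall h, \sum_p mu h p = 1) ->
  0 < delta -> #|T|%:R * delta <= 1 ->
  forall (t : nat) (U : {set T}) h, (0 < #|U|)%N ->
  exists ps, [/\ (size ps <= t + #|U|)%N, exists2 q, q \in U & q \notin ps &
    Num.min (t%:R * delta)
      ((1 - #|T|%:R * delta) * (harmonic_number R #|U| - 1)) <= gain mu h ps].
Proof.
set g := 1 - _ => mu1 delta0 Tdelta t U.
have g0 : 0 <= g by rewrite subr_ge0.
(* Each hit lowers [t] or [#|U|] by one. *)
have [N] := ubnP (t + #|U|)%N; elim: N t U => // N IH t U ltN h U0.
have [q0 q0U] : exists q, q \in U by apply/card_gt0P.
have [U1|U1] := eqVneq #|U| 1%N.
  exists [::]; split => //; first by exists q0.
  by rewrite U1 harmonic_number1 subrr mulr0 ge_min lexx orbT.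
(* A hit outside [U] spends one unit of [t] and gains at least [delta]; once [t] is 0 the bound is
   at most 0. *)
have [/existsP[p /andP[pU pdelta]]|/existsPn noheavy] :=
    boolP [exists p, (p \notin U) && (delta <= mu h p)].
  case: t ltN => [|t] ltN.
    by exists [::]; split => //; [exists q0|rewrite mul0r ge_min lexx].
  have [|ps [sz [q qU qps] le1]] := IH t U _ (rcons h p) U0; first exact: ltN.
  exists (p :: ps); split => //=.
    exists q => //; rewrite inE negb_or qps andbT.
    by apply: contraNneq pU => <-.
  move: le1; rewrite !ge_min -natr1 => /orP[le1|le1]; apply/orP.
    by left; lra.
  by right; lra.
(* The points outside [U] now carry at most [#|T| * delta] in total, so the average over [U] is at
   least [g / #|U|], which is [g] times the last term of the harmonic sum. *)
have [p pU pg] : exists2 p, p \in U & g / #|U|%:R <= mu h p.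
  apply: contrapT => nop; suff : \sum_p mu h p < 1 by rewrite mu1 ltxx.
  have small p : p \in U -> mu h p < g / #|U|%:R.
    by move=> pU; rewrite ltNge; apply/negP => pg; apply: nop; exists p.
  rewrite (bigID (mem U)) /=.
  have s1 : \sum_(p in U) mu h p < g.
    rewrite [ltRHS](_ : _ = \sum_(p in U) g / #|U|%:R); last first.
      by rewrite sumr_const -[RHS]mulr_natr divfK // pnatr_eq0 -lt0n.
    by apply: ltr_sum => //; apply/hasP; exists q0; rewrite ?mem_index_enum.
  have s2 : \sum_(p | p \notin U) mu h p <= #|T|%:R * delta.
    apply: (@le_trans _ _ (\sum_(p | p \notin U) delta)).
      apply: ler_sum => p pU.
      by have := noheavy p; rewrite pU /= -ltNge => /ltW.
    by rewrite sumr_const -[leLHS]mulr_natl ler_wpM2r ?ler_nat ?max_card ?ltW.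
  by rewrite /g in s1; lra.
have cU : #|U| = #|U :\ p|%SET.+1 by rewrite (cardsD1 p) pU.
have [||ps [sz [q /setD1P[qp qU] qps] le1]] := IH t (U :\ p)%SET _ (rcons h p).
- by move: ltN; rewrite cU addnS ltnS.
- by move: U1 U0; rewrite cU; case: #|_|.
exists (p :: ps); split => /=.
- by rewrite cU addnS ltnS.
- by exists q; rewrite // inE negb_or qp.
move: le1 pg; rewrite cU harmonic_numberS !ge_min.
move=> /orP[le1|le1] pg; apply/orP.
  left; apply: le_trans le1 _; rewrite lerDr.
  by apply: le_trans pg; rewrite divr_ge0.
by right; move: (lerD pg le1); rewrite -mulrDr addrA [_^-1 + _]addrC.
Qed.

Section Expectation.
Variables (d : measure_display) (Omega : measurableType d).
Variable P : probability Omega R.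
Variables (T : finType) (X : Omega -> seq T -> T).
Hypothesis X_meas : forall h p, measurable [set omega | X omega h = p]%classic.

Definition mass h p : R := fine (P [set omega | X omega h = p]%classic).

Lemma eq_indic omega h p :
  (X omega h == p)%:R = \1_[set omega | X omega h = p]%classic omega :> R.
Proof.
rewrite indicE; congr (_%:R); congr nat_of_bool.
by apply/eqP/idP => [?|]; rewrite inE.
Qed.

Lemma massE h p : (mass h p)%:E = P [set omega | X omega h = p]%classic.
Proof. by rewrite fineK // fin_num_measure. Qed.

Lemma measurable_hit h p :
  measurable_fun [set: Omega]%classic
    (EFin \o (fun omega => (X omega h == p)%:R : R)).
Proof.
under eq_fun do rewrite eq_indic.
by apply/measurable_EFinP; exact: measurable_indic.
Qed.

Lemma integral_hit h p :
  (\int[P]_omega ((X omega h == p)%:R : R)%:E = (mass h p)%:E)%E.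
Proof.
under eq_integral do rewrite eq_indic.
by rewrite integral_indic // setIT massE.
Qed.

Lemma sum_mass h : \sum_p mass h p = 1.
Proof.
apply: EFin_inj; rewrite -sumEFin.
under eq_bigr do rewrite -integral_hit.
rewrite -ge0_integral_sum //; first last.
- by move=> p; exact: measurable_hit.
under eq_integral => omega _.
  rewrite sumEFin (bigD1 (X omega h)) //= eqxx big1 ?addr0 => [|p /negPf ne].
    over.
  by rewrite eq_sym ne.
by rewrite integral_cst // mul1e; exact: probability_setT.
Qed.

Lemma measurable_gain h ps : measurable_fun [set: Omega]%classic
  (EFin \o (fun omega => gain (fun h p => (X omega h == p)%:R) h ps)).
Proof.
elim: ps h => [|p ps IH] h /=; first exact: measurable_cst.
by apply/measurable_EFinP/measurable_funD; apply/measurable_EFinP;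
  [exact: measurable_hit|exact: IH].
Qed.

(** Linearity of expectation, the hits [ps] being fixed in advance: it turns the count of hits in
    one run into the deterministic gain of [exists_gain]. *)
Lemma integral_gain h ps :
  (\int[P]_omega (gain (fun h p => (X omega h == p)%:R) h ps)%:E =
   (gain mass h ps)%:E)%E.
Proof.
elim: ps h => [|p ps IH] h /=; first by rewrite integral0.
under eq_integral do rewrite EFinD.
rewrite ge0_integralD //=.
- by rewrite integral_hit IH.
- exact: measurable_hit.
- by move=> omega _; rewrite lee_fin gain_ge0.
- exact: measurable_gain.
Qed.

End Expectation.
End Gain.

(* Unlike [ge0_le_integral], this requires no measurability. *)
Lemma ge0_le_integral_nonmeas d (T : measurableType d) (R : realType)
    (mu : {measure set T -> \bar R}) (f g : T -> \bar R) :
  (forall x, 0 <= f x)%E -> (forall x, f x <= g x)%E ->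
  (\int[mu]_x f x <= \int[mu]_x g x)%E.
Proof.
move=> f0 fg; have g0 x : (0 <= g x)%E := le_trans (f0 x) (fg x).
rewrite !ge0_integralTE //; apply: ereal_sup_le => _ [h hf <-].
by exists h => // x; apply: le_trans (hf x) (fg x).
Qed.

(** * Offline optimum and online schedules *)

Section OptCost.
Variables (R : realType) (m k : nat) (w : 'I_k -> R).
Hypothesis w_ge0 : forall i, 0 <= w i.

Lemma opt_cost_ge0 (init : config m k) (s : seq 'I_m) :
  (0 <= opt_cost w init s)%E.
Proof.
by apply: le_bigmin => [|cs _]; rewrite ?leey // lee_fin sched_cost_ge0.
Qed.

Lemma opt_cost_le (init : config m k) (s : seq 'I_m) cs :
  serves s cs -> (opt_cost w init s <= (sched_cost w init cs)%:E)%E.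
Proof.
move=> h; pose t := Tuple (introT eqP (serves_size h)).
exact: (@bigmin_le_cond _ _ _ _ t).
Qed.

End OptCost.

Section Algorithm.
Variables (R : realType) (m k : nat) (d : measure_display).
Variables (Omega : measurableType d).
Variable A : Omega -> config m k -> seq 'I_m -> config m k.
Hypothesis A_online : randomized_online_alg A.
Variable init : config m k.

Lemma alg_sched_rcons omega s r :
  alg_sched A omega init (rcons s r) =
  rcons (alg_sched A omega init s) (A omega init (rcons s r)).
Proof.
rewrite /alg_sched size_rcons -addn1 iotaD map_cat /= cats1 add0n.
rewrite -(size_rcons s r) take_size; congr rcons.
apply/eq_in_map => t; rewrite mem_iota add0n => /= ts.
by rewrite -cats1 takel_cat.
Qed.

(** Requests to come do not alter the configurations already chosen, so the cost splits block by
    block. *)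
Lemma alg_sched_cat omega s1 s2 :
  exists2 cs, alg_sched A omega init (s1 ++ s2) =
              alg_sched A omega init s1 ++ cs & serves s2 cs.
Proof.
elim/last_ind: s2 => [|s2 r [cs e h]]; first by exists [::]; rewrite ?cats0.
exists (rcons cs (A omega init (rcons (s1 ++ s2) r))).
  by rewrite -rcons_cat alg_sched_rcons e rcons_cat.
by rewrite -!cats1 serves_cat //= andbT cats1; apply: (proj1 A_online).
Qed.

Definition position omega s i := last init (alg_sched A omega init s) i.

Lemma measurable_position s i p :
  measurable [set omega | position omega s i = p]%classic.
Proof.
have cfg c : measurable
    [set omega | last init (alg_sched A omega init s) = c]%classic.
  case/lastP: s => [|s r] /=.
    (* On the empty prefix the position is read from [init], not from [A omega init [::]]. *)
    have [->|ne] := eqVneq init c.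
      by rewrite (_ : mkset _ = setT) //; apply/seteqP.
    by rewrite (_ : mkset _ = set0) //; apply/seteqP; split => // x /eqP;
      rewrite (negPf ne).
  under eq_set do rewrite alg_sched_rcons last_rcons.
  exact: (proj2 A_online).
rewrite (_ : mkset _ = \bigcup_(c in [set c : config m k | c i = p])
    [set omega | last init (alg_sched A omega init s) = c])%classic.
  by apply: fin_bigcup_measurable => [|c _]; [exact: finite_finset|exact: cfg].
apply/seteqP; split => [omega h|omega [c ci e]]; last by rewrite /= /position e.
by exists (last init (alg_sched A omega init s)).
Qed.

End Algorithm.

(** * Online and offline cost of a sequence of hits *)

Section Hits.
Variables (R : realType) (m k beta : nat) (d : measure_display).
Let wt (i : 'I_k.+1) : R := (beta ^ i)%:R.
Variables (Omega : measurableType d).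
Variable A : Omega -> config m k.+1 -> seq 'I_m -> config m k.+1.
Hypothesis A_online : randomized_online_alg A.
Variable init : config m k.+1.
Variable rho : 'I_m -> seq 'I_m.
Hypothesis rho_hard : forall p, hard R k.+1 beta k [set~ p]%SET (rho p).
Let sigma h := flatten (map rho h).
Let X omega h := position A init omega (sigma h) ord_max.

(** A bound for each seed: when the heaviest server is at p, it is outside the complement of p, so
    [rho p] costs at least [beta ^ k]; every other hit is counted as 0. *)
Lemma gain_le_cost omega h ps :
  sched_cost wt init (alg_sched A omega init (sigma h)) +
    (beta ^ k)%:R * gain (fun h p => (X omega h == p)%:R) h ps <=
  sched_cost wt init (alg_sched A omega init (sigma (h ++ ps))).
Proof.
elim: ps h => [|p ps IH] h /=; first by rewrite mulr0 addr0 cats0.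
rewrite -cat_rcons; apply: le_trans (IH _); rewrite mulrDr addrA lerD2r.
have [cs e hs] := alg_sched_cat A_online init omega (sigma h) (rho p).
have -> : sigma (rcons h p) = sigma h ++ rho p.
  by rewrite /sigma map_rcons flatten_rcons.
rewrite e sched_cost_cat lerD2l; case: eqP => Xp; last first.
  by rewrite mulr0 sched_cost_ge0 //; exact: wt_ge0.
rewrite mulr1; apply: rho_hard hs => i ki.
have -> : i = ord_max by apply/val_inj/anti_leq; rewrite ki -ltnS ltn_ord.
rewrite -/(position A init omega (sigma h) ord_max) -/(X omega h).
by rewrite Xp !inE eqxx.
Qed.

Lemma expected_cost_ge (P : probability Omega R) ps :
  (((beta ^ k)%:R * gain (mass P X) [::] ps)%:E <=
   \int[P]_omega (sched_cost wt init (alg_sched A omega init (sigma ps)))%:E)%E.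
Proof.
have X_meas h p : measurable [set omega | X omega h = p]%classic.
  exact: measurable_position.
rewrite EFinM -(integral_gain P X_meas) -ge0_integralZl_EFin //.
(* The algorithm's cost is bounded below without showing that it is measurable in [omega]. *)
- apply: ge0_le_integral_nonmeas => omega.
    by rewrite -EFinM lee_fin mulr_ge0 // gain_ge0.
  by rewrite -EFinM lee_fin; have := gain_le_cost omega [::] ps; rewrite add0r.
- by move=> omega _; rewrite lee_fin gain_ge0.
- exact: measurable_gain.
Qed.

(** As q is never hit, it lies in the complement of every hit point: one move of the heaviest server
    to q makes all blocks easy. *)
Lemma offline_cost_le (B : R) q ps :
  (forall p, easy k.+1 beta k [set~ p]%SET (rho p) B) -> q \notin ps ->
  (opt_cost wt init (sigma ps) <= ((beta ^ k)%:R + (size ps)%:R * B)%:E)%E.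
Proof.
move=> rho_easy qps.
pose c' : config m k.+1 := [ffun j => if j == ord_max then q else init j].
have [|cs [h le1 _]] := easy_flatten rho_easy (js := ps) (c := c').
  move=> p pps; exists ord_max => //.
  by rewrite ffunE eqxx !inE; apply: contraNneq qps => ->.
apply: le_trans (opt_cost_le _ _ h) _; rewrite lee_fin.
apply: le_trans (sched_cost_start (@wt_ge0 R _ _) init c' cs) _.
apply: lerD le1; rewrite /move_cost big_mkcond (bigD1 ord_max) //= big1.
  by rewrite addr0; case: ifP.
by move=> j /negPf jo; rewrite ffunE jo eqxx.
Qed.

End Hits.

(** * Choice of the constants and conclusion *)

Unset Implicit Arguments.

Theorem theorem2 (R : realType) (k : nat) (alpha : R) :
  (1 <= k)%N -> alpha < @harmonic_number R (nseqk k.-1) ->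
  exists beta : nat, (0 < beta)%N /\
    forall (d : measure_display) (Omega : measurableType d)
           (P : probability Omega R)
           (A : Omega -> config (nseqk k.-1).+1 k -> seq 'I_(nseqk k.-1).+1 ->
                config (nseqk k.-1).+1 k),
      randomized_online_alg A ->
      ~ competitive P (fun i : 'I_k => (beta ^ i)%:R) A alpha.
Proof.
case: k => // k _ /=; set n := nseqk k; set H := harmonic_number R n => alphaH.
have n0 : (0 < n)%N := nseqk_gt0 k.
have H1 : 1 <= H := harmonic_number_ge1 R n0.
(* [alpha] may be negative, whereas scaling the offline bound needs a nonnegative ratio. *)
pose a := Num.max alpha 0.
have a0 : 0 <= a by rewrite le_max lexx orbT.
have aH : a < H by rewrite gt_max alphaH; lra.
have [K HK] := hard_easy_sequence R k.
(* Chosen so that the factor [1 - n.+1 * delta] takes [H] down to (H + a) / 2, halfway to [a]. *)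
pose delta : R := (H - a) / (2 * n.+1%:R * H).
have delta0 : 0 < delta by rewrite divr_gt0 ?subr_gt0 ?mulr_gt0 //; lra.
have n1 : n.+1%:R != 0 :> R by rewrite pnatr_eq0.
have Hn0 : H != 0 by lra.
have Hdelta : H * (1 - n.+1%:R * delta) = (H + a) / 2.
  by rewrite /delta; move: (n.+1%:R : R) n1 => x x0; field; rewrite Hn0 x0.
have ndelta : n.+1%:R * delta <= 1.
  by rewrite -subr_ge0 -(pmulr_rge0 (x := H)) ?Hdelta; lra.
(* Enough budget for hits worth [delta] to add up to [H]. *)
pose t := (Num.trunc (H / delta)).+1.
have tdelta : H <= t%:R * delta.
  by rewrite -ler_pdivrMr // ltW // truncnS_gt.
(* Bounds the number of hits: the first at [ord0], then at most [t + n]. *)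
pose N := (t + n).+1.
(* Large enough for the offline overhead [a * N * K / beta] to stay below (H - a) / 2. *)
pose beta := (Num.trunc (2 * a * N%:R * K%:R / (H - a))).+1.
exists beta; split => // d Omega P A A_online compA.
have beta0 : (0 < beta)%N by [].
have /choice[rho rhoP] : forall p : 'I_n.+1, exists s,
    hard R k.+1 beta k [set~ p]%SET s /\
    easy k.+1 beta k [set~ p]%SET s ((K * beta ^ k)%:R / beta%:R : R).
  by move=> p; apply: HK; rewrite // cardsC1 card_ord.
(* All servers start at [ord0], so the first hit there gains 1, which makes up for the -1 in
   [exists_gain]. *)
pose init : config n.+1 k.+1 := [ffun=> ord0].
pose mu := mass P (fun omega h =>
  position A init omega (flatten (map rho h)) ord_max).
have mu1 h : \sum_p mu h p = 1.
  by apply: sum_mass => ? ?; exact: measurable_position.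
have [||ps [szps [q q0 qps] gps]] := exists_gain mu1 delta0 _ t
    (U := [set~ ord0]%SET) [:: ord0].
- by rewrite card_ord.
- by rewrite cardsC1 card_ord.
have mu0 : mu [::] ord0 = 1.
  rewrite /mu /mass (_ : mkset _ = setT) ?probability_setT //.
  by apply/seteqP; split => // omega _; rewrite /= /position /= ffunE.
move: gps szps; rewrite cardsC1 card_ord /= -/H => gps szps.
(* In the second case, 1 + (1 - x)(H - 1) >= (1 - x) H with x = [n.+1 * delta]. *)
have gain_ge : (H + a) / 2 <= gain mu [::] (ord0 :: ps).
  rewrite /= mu0; move: gps; rewrite ge_min => /orP[le1|]; first by lra.
  rewrite mulrBr mulr1 [_ * H]mulrC Hdelta.
  have : 0 <= n.+1%:R * delta by rewrite mulr_ge0 // ltW.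
  by move: (n.+1%:R * delta) => x; lra.
have q_fresh : q \notin ord0 :: ps.
  by rewrite inE negb_or qps andbT; move: q0; rewrite !inE.
have lower := expected_cost_ge A_online init (fun p => proj1 (rhoP p)) P
  (ord0 :: ps).
have upper := offline_cost_le init (fun p => proj2 (rhoP p)) q_fresh.
set s := flatten _ in lower upper.
set W : R := (beta ^ k)%:R in lower upper.
have W0 : 0 < W by rewrite ltr0n expn_gt0.
set V := W + _ in upper.
have : W * gain mu [::] (ord0 :: ps) <= a * V.
  rewrite -lee_fin; apply: le_trans lower _; apply: le_trans (compA init s) _.
  have opt0 : (0 <= opt_cost (fun i : 'I_k.+1 => (beta ^ i)%:R : R) init s)%E.
    by apply: opt_cost_ge0 => i; rewrite ler0n.
  apply: le_trans (lee_wpmul2r opt0 (y := a%:E) _) _.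
    by rewrite lee_fin le_max lexx.
  by rewrite EFinM; apply: lee_wpmul2l; rewrite ?lee_fin.
apply/negP; rewrite -ltNge.
have betaR0 : 0 < beta%:R :> R by rewrite ltr0n.
have VN : V <= W * (1 + N%:R * K%:R / beta%:R).
  rewrite /V natrM -/W mulrDr mulr1 lerD2l.
  rewrite [leRHS](_ : _ = N%:R * (K%:R * W / beta%:R)); last by ring.
  by rewrite ler_wpM2r ?ler_nat // divr_ge0 // mulr_ge0 // ltW.
apply: le_lt_trans (ler_wpM2l a0 VN) _.
rewrite mulrCA ltr_pM2l //; apply: lt_le_trans gain_ge.
have : 2 * a * N%:R * K%:R / (H - a) < beta%:R by exact: truncnS_gt.
rewrite ltr_pdivrMr ?subr_gt0 // => betaP.
have -> : a * (1 + N%:R * K%:R / beta%:R) =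
    a + 2 * a * N%:R * K%:R / beta%:R / 2.
  by field; rewrite gt_eqF.
suff : 2 * a * N%:R * K%:R / beta%:R < H - a by lra.
by rewrite ltr_pdivrMr // [ltRHS]mulrC.
Qed.
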